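(* Let $(\mathfrak g,[\cdot,\cdot],\alpha,d)$ be an object of $\mathbf{HomLieDer}_\alpha$. Let $(\mathcal F_{\mathrm m}(\mathfrak g),\mu_{\mathrm m},\alpha_{\mathrm m})$ be the free Hom-nonassociative algebra on the Hom-module $(\mathfrak g,\alpha)$, with canonical Hom-module morphism $j:\mathfrak g\to\mathcal F_{\mathrm m}(\mathfrak g)$. Then there exists a unique linear map $\widehat d:\mathcal F_{\mathrm m}(\mathfrak g)\to\mathcal F_{\mathrm m}(\mathfrak g)$ such that $$\widehat d\circ j=j\circ d,\qquad \widehat d\circ\alpha_{\mathrm m}=\alpha_{\mathrm m}\circ\widehat d,$$ $$\widehat d(xy)=\widehat d(x)\alpha_{\mathrm m}(y)+\alpha_{\mathrm m}(x)\widehat d(y)\qquad\text{for all }x,y\in\mathcal F_{\mathrm m}(\mathfrak g).$$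
   Context: All vector spaces are over a fixed field $\mathbb{K}$ of characteristic $0$. An object $(\mathfrak g,[\cdot,\cdot],\alpha,d)$ of $\mathbf{HomLieDer}_\alpha$ is a Hom-Lie algebra with an $\alpha$-derivation: $[\cdot,\cdot]$ is a skew-symmetric bilinear map on the vector space $\mathfrak g$, $\alpha,d:\mathfrak g\to\mathfrak g$ are linear, $[\alpha(x),[y,z]]+[\alpha(y),[z,x]]+[\alpha(z),[x,y]]=0$, $\alpha([x,y])=[\alpha(x),\alpha(y)]$, $d\circ\alpha=\alpha\circ d$ and $d([x,y])=[d(x),\alpha(y)]+[\alpha(x),d(y)]$ for all $x,y,z\in\mathfrak g$. A Hom-module $(V,\alpha_V)$ is a vector space with a linear endomorphism; a morphism $(V,\alpha_V)\to(W,\alpha_W)$ is a linear map $f$ with $f\alpha_V=\alpha_Wf$. A Hom-nonassociative algebra is a triple $(A,\mu,\alpha)$ with $\mu:A\times A\to A$ bilinear (written $ab$), $\alpha:A\to A$ linear and $\alpha(ab)=\alpha(a)\alpha(b)$ (no associativity, no unit); morphisms are linear maps preserving products and twisting maps. Construction of $\mathcal F_{\mathrm m}(V)$ for a Hom-module $(V,\alpha_V)$. For $n\ge1$ a weighted $n$-tree is a planar binary tree with $n$ leaves and a nonnegative integer attached to each internal vertex (the one-leaf tree has no internal vertex); $T_n^{\mathrm{wt}}$ is the set of these. For $\tau\in T_p^{\mathrm{wt}},\sigma\in T_q^{\mathrm{wt}}$, $\tau\vee\sigma\in T_{p+q}^{\mathrm{wt}}$ joins the two roots to a new lowest internal vertex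 of weight $0$ ($\tau$ left, $\sigma$ right); for $n\ge2$, $\tau[1]$ adds $1$ to the weight of the lowest internal vertex of $\tau\in T_n^{\mathrm{wt}}$. Let $F_{\mathrm{HNAs}}(V)=\bigoplus_{n\ge1}\bigoplus_{\tau\in T_n^{\mathrm{wt}}}V^{\otimes n}_\tau$ with $V^{\otimes n}_\tau$ a copy of $V^{\otimes n}$, and product $\mu_F((x_1\otimes\cdots\otimes x_n)_\tau,(x_{n+1}\otimes\cdots\otimes x_{n+m})_\sigma)=(x_1\otimes\cdots\otimes x_{n+m})_{\tau\vee\sigma}$; let $\alpha_F$ be the linear map with $\alpha_F|_V=\alpha_V$ and $\alpha_F((x_1\otimes\cdots\otimes x_n)_\tau)=(x_1\otimes\cdots\otimes x_n)_{\tau[1]}$ for $n\ge2$. Let $M_1$ be the two-sided ideal generated by all $\alpha_F(uv)-\alpha_F(u)\alpha_F(v)$, $M_{n+1}$ the two-sided ideal generated by $M_n\cup\alpha_F(M_n)$, $M_\infty=\bigcup_{n\ge1}M_n$. Then $\mathcal F_{\mathrm m}(V)=F_{\mathrm{HNAs}}(V)/M_\infty$ with induced product $\mu_{\mathrm m}$ and twisting map $\alpha_{\mathrm m}$, and $j:V\to\mathcal F_{\mathrm m}(V)$ is the inclusion of $V$ (the $n=1$ summand) followed by the quotient map. It is the free Hom-nonassociative algebra on $(V,\alpha_V)$: every Hom-module morphism from $V$ to a Hom-nonassociative algebra $A$ factors uniquely as $\overline f\circ j$ with $\overline f:\mathcal F_{\mathrm m}(V)\to A$ a morphism of Hom-nonassociative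 algebras. *)

(* Defs.v *)
From HB Require Import structures.
From mathcomp Require Import all_boot all_algebra.
From mathcomp Require Import generic_quotient ring_quotient sesquilinear.
From mathcomp Require Import boolp classical_sets functions cardinality.
From mathcomp Require Import finmap.
From mathcomp.multinomials Require Import monalg.

Set Implicit Arguments.
Unset Strict Implicit.
Unset Printing Implicit Defensive.

Import GRing.Theory.
Local Open Scope classical_set_scope.
Local Open Scope quotient_scope.
Local Open Scope ring_scope.

Section Subspace.
Variables (K : fieldType) (E : lmodType K).

Definition is_subspace (A : set E) : Prop :=
  A 0 /\ forall (a : K) x y, A x -> A y -> A (a *: x + y).

Record subspace := Subspace { subspace_set : set E; _ : is_subspace subspace_set }.

Lemma subspaceP (I : subspace) : is_subspace (subspace_set I).
Proof. by case: I. Qed.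

Definition subspace_pred (I : subspace) : {pred E} := mem (subspace_set I : set E).

Lemma subspace_predP (I : subspace) x : reflect (subspace_set I x) (x \in subspace_pred I).
Proof. exact: asboolP. Qed.

Lemma subspace_submod_closed (I : subspace) : submod_closed (subspace_pred I).
Proof.
have [I0 ID] := subspaceP I.
split=> [|a x y /subspace_predP Ix /subspace_predP Iy]; apply/subspace_predP=> //.
exact: ID.
Qed.

HB.instance Definition _ (I : subspace) :=
  GRing.isSubmodClosed.Build K E (subspace_pred I) (subspace_submod_closed I).

Lemma lspan_subspace (S : set E) : is_subspace (smallest is_subspace S).
Proof.
split=> [A [[]] //|a x y Sx Sy A hA]; have [[_ AD] _] := hA.
by apply: AD; [apply: Sx|apply: Sy].
Qed.

Definition lspan (S : set E) : subspace := Subspace (lspan_subspace S).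

Lemma lspan_ker (W : lmodType K) (f : {linear E -> W}) (S : set E) :
  (forall x, S x -> f x = 0) -> forall x, subspace_set (lspan S) x -> f x = 0.
Proof.
move=> S0 x; apply: (_ : smallest _ _ `<=` [set x | f x = 0]) => /= {x}.
apply: smallest_sub => //; split=> [|a y z /= fy fz]; first exact: linear0.
by rewrite linearP fy fz scaler0 addr0.
Qed.

End Subspace.

Section LinearQuotient.
Variables (K : fieldType) (E : lmodType K) (I : subspace E).

Definition lquot : Type := Quotient.quot (subspace_pred I).

HB.instance Definition _ := GRing.Zmodule.on lquot.
Definition lpi (x : E) : lquot := \pi_(Quotient.quot (subspace_pred I)) x.
Definition lrepr (z : lquot) : E := @repr _ (Quotient.quot (subspace_pred I)) z.

Lemma lreprK : cancel lrepr lpi.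
Proof. exact: reprK. Qed.

Lemma lpi_surj (z : lquot) : exists x, z = lpi x.
Proof. by exists (lrepr z); rewrite lreprK. Qed.

Lemma lpi_eqP (x y : E) : lpi x = lpi y <-> subspace_set I (x - y).
Proof.
have := Quotient.idealrBE (subspace_pred I) x y.
by case: subspace_predP => [h /esym/eqP//|h /esym/eqP].
Qed.

Lemma lpiD : {morph lpi : x y / x + y}.
Proof. exact: (@Quotient.pi_add E (subspace_pred I)). Qed.

Definition lquot_scale (a : K) (z : lquot) : lquot := lpi (a *: lrepr z).

Lemma lpiZ a (x : E) : lpi (a *: x) = lquot_scale a (lpi x).
Proof.
apply/lpi_eqP; rewrite -scalerBr -[_ *: _]addr0.
have [I0 ID] := subspaceP I.
by apply: ID => //; apply/lpi_eqP; rewrite lreprK.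
Qed.

Lemma lquot_scaleA a b z :
  lquot_scale a (lquot_scale b z) = lquot_scale (a * b) z.
Proof. by have [x ->] := lpi_surj z; rewrite -!lpiZ scalerA. Qed.

Lemma lquot_scale1 : left_id 1 lquot_scale.
Proof. by move=> z; have [x ->] := lpi_surj z; rewrite -lpiZ scale1r. Qed.

Lemma lquot_scaleDr : right_distributive lquot_scale +%R.
Proof.
move=> a z t; have [x ->] := lpi_surj z; have [y ->] := lpi_surj t.
by rewrite -lpiD -!lpiZ scalerDr lpiD.
Qed.

Lemma lquot_scaleDl z : {morph lquot_scale^~ z : a b / a + b}.
Proof.
by move=> a b; have [x ->] := lpi_surj z; rewrite -!lpiZ scalerDl lpiD.
Qed.

HB.instance Definition _ := GRing.Zmodule_isLmodule.Build K lquot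
  lquot_scaleA lquot_scale1 lquot_scaleDr lquot_scaleDl.

Lemma lpi_is_linear : linear lpi.
Proof. by move=> a x y; rewrite lpiD lpiZ. Qed.

HB.instance Definition _ := GRing.isLinear.Build K E lquot *:%R lpi lpi_is_linear.

(** Meaningful for linear [f] vanishing on [I]: see [qliftE]. *)
Definition qlift (W : lmodType K) (f : E -> W) (z : lquot) : W := f (lrepr z).

Lemma qliftE (W : lmodType K) (f : {linear E -> W}) :
  (forall x, subspace_set I x -> f x = 0) -> forall x, qlift f (lpi x) = f x.
Proof.
move=> f0 x; apply/eqP; rewrite -subr_eq0 -raddfB; apply/eqP/f0.
by apply/lpi_eqP; rewrite lreprK.
Qed.

Lemma qlift_is_linear (W : lmodType K) (f : {linear E -> W}) :
  (forall x, subspace_set I x -> f x = 0) -> linear (qlift f).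
Proof.
move=> f0 a z t; have [x ->] := lpi_surj z; have [y ->] := lpi_surj t.
by rewrite -linearP !qliftE // linearP.
Qed.

End LinearQuotient.


Section DirectSum.
Variables (K : fieldType) (T : Type) (M : T -> lmodType K).

Record dsum := DSum {
  dsum_fun :> forall t, M t;
  dsum_fin : finite_set [set t | dsum_fun t != 0] }.

Lemma dsumP (u v : dsum) : (forall t, u t = v t) <-> u = v.
Proof.
split=> [|->//]; case: u v => [u hu] [v hv] /= uv.
have e : u = v by apply: functional_extensionality_dep.
by case: _ / e hv {uv} => hv; congr DSum; apply: Prop_irrelevance.
Qed.

HB.instance Definition _ := gen_eqMixin dsum.
HB.instance Definition _ := gen_choiceMixin dsum.

Lemma dsum0_fin : finite_set [set t | (0 : M t) != 0].
Proof. by rewrite (_ : mkset _ = set0) // -subset0 => t /=; rewrite eqxx. Qed.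

Lemma dsumD_fin (u v : dsum) : finite_set [set t | u t + v t != 0].
Proof.
apply: (@sub_finite_set _ _ ([set t | u t != 0] `|` [set t | v t != 0])).
  move=> t /= uv; have [u0|] := eqVneq (u t) 0; last by left.
  by right; rewrite u0 add0r in uv.
by rewrite finite_setU; split; apply: dsum_fin.
Qed.

Lemma dsumZ_fin (a : K) (u : dsum) : finite_set [set t | a *: u t != 0].
Proof.
apply: sub_finite_set (dsum_fin u) => t /=; apply: contraNN => /eqP ->.
by rewrite scaler0.
Qed.

Definition dsum0 := DSum dsum0_fin.
Definition dsumD u v := DSum (dsumD_fin u v).
Definition dsumZ a u := DSum (dsumZ_fin a u).

Lemma dsum_addA : associative dsumD.
Proof. by move=> u v w; apply/dsumP => t /=; rewrite addrA. Qed.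
Lemma dsum_addC : commutative dsumD.
Proof. by move=> u v; apply/dsumP => t /=; rewrite addrC. Qed.
Lemma dsum_add0 : left_id dsum0 dsumD.
Proof. by move=> u; apply/dsumP => t /=; rewrite add0r. Qed.
Lemma dsum_addN : left_inverse dsum0 (dsumZ (- 1)) dsumD.
Proof. by move=> u; apply/dsumP => t /=; rewrite scaleN1r addNr. Qed.

HB.instance Definition _ :=
  GRing.isZmodule.Build dsum dsum_addA dsum_addC dsum_add0 dsum_addN.

Lemma dsum_scaleA a b u : dsumZ a (dsumZ b u) = dsumZ (a * b) u.
Proof. by apply/dsumP => t /=; rewrite scalerA. Qed.
Lemma dsum_scale1 : left_id 1 dsumZ.
Proof. by move=> u; apply/dsumP => t /=; rewrite scale1r. Qed.
Lemma dsum_scaleDr : right_distributive dsumZ +%R.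
Proof. by move=> a u v; apply/dsumP => t /=; rewrite scalerDr. Qed.
Lemma dsum_scaleDl u : {morph dsumZ^~ u : a b / a + b}.
Proof. by move=> a b; apply/dsumP => t /=; rewrite scalerDl. Qed.

HB.instance Definition _ := GRing.Zmodule_isLmodule.Build K dsum
  dsum_scaleA dsum_scale1 dsum_scaleDr dsum_scaleDl.

Lemma dsumPE a (u v : dsum) t : (a *: u + v) t = a *: u t + v t.
Proof. by []. Qed.

Lemma dsum_in_fin t (x : M t) :
  finite_set [set s | (if pselect (t = s) is left e then ecast s (M s) e x
                       else 0 : M s) != 0].
Proof.
apply: (@sub_finite_set _ _ [set t]); last exact: finite_set1.
by move=> s /=; case: pselect => [|? /eqP].
Qed.

Definition dsum_in t (x : M t) : dsum := DSum (dsum_in_fin x).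

Lemma dsum_in_eq t (x : M t) : dsum_in x t = x.
Proof.
rewrite /=; case: pselect => // e.
by rewrite (Prop_irrelevance e (erefl t)).
Qed.

Lemma dsum_in_neq t s (x : M t) : t <> s -> dsum_in x s = 0.
Proof. by move=> /= ts; case: pselect. Qed.

Lemma dsum_in_is_linear t : linear (@dsum_in t).
Proof.
move=> a x y; apply/dsumP => s; rewrite dsumPE.
have [<-|ts] := pselect (t = s); first by rewrite !dsum_in_eq.
by rewrite !dsum_in_neq // scaler0 addr0.
Qed.

HB.instance Definition _ t :=
  GRing.isLinear.Build K (M t) dsum *:%R (@dsum_in t) (@dsum_in_is_linear t).

End DirectSum.

Section FreeLift.
Variables (K : fieldType) (X : choiceType) (W : lmodType K) (f : X -> W).

Definition malg_lift (p : {malg K[X]}) : W := \sum_(x <- msupp p) p@_x *: f x.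

Lemma malg_lift_wide (p : {malg K[X]}) (D : {fset X}) :
  fsubset (msupp p) D -> malg_lift p = \sum_(x <- D) p@_x *: f x.
Proof.
move=> pD; apply: big_fset_incl => // x _ /mcoeff_outdom ->.
by rewrite scale0r.
Qed.

Lemma malg_lift_is_linear : linear malg_lift.
Proof.
move=> a p q; pose D := fsetU (msupp (a *: p + q)) (fsetU (msupp p) (msupp q)).
rewrite !(@malg_lift_wide _ D); last 3 first.
- by apply: fsubset_trans (fsubsetUr _ _); apply: fsubsetUr.
- by apply: fsubset_trans (fsubsetUr _ _); apply: fsubsetUl.
- exact: fsubsetUl.
rewrite scaler_sumr -big_split; apply: eq_bigr => x _ /=.
by rewrite mcoeffD mcoeffZ scalerDl scalerA.
Qed.

HB.instance Definition _ :=
  GRing.isLinear.Build K {malg K[X]} W *:%R malg_lift malg_lift_is_linear.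

Lemma malg_liftU x : malg_lift << x >> = f x.
Proof.
by rewrite /malg_lift msuppU oner_eq0 big_seq_fset1 mcoeffU eqxx scale1r.
Qed.

End FreeLift.

Lemma lin_interchange (K : fieldType) (W : lmodType K) (a b : K) (u v u' v' : W) :
  a *: (b *: u + v) + (b *: u' + v') = b *: (a *: u + u') + (a *: v + v').
Proof. by rewrite !scalerDr !scalerA [b * a]mulrC addrACA. Qed.

Section TensorPower.
Variables (K : fieldType) (V : lmodType K).

Definition slot_comb n (i : 'I_n) (a : K) (x y z : n.-tuple V) : Prop :=
  (forall k, k != i -> tnth x k = tnth z k /\ tnth y k = tnth z k) /\
  tnth z i = a *: tnth x i + tnth y i.

Definition multilinear n (W : lmodType K) (f : n.-tuple V -> W) : Prop :=
  forall i a x y z, slot_comb i a x y z -> f z = a *: f x + f y.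

Definition tensor_rel n : set {malg K[n.-tuple V]} :=
  [set r | exists i a x y z, slot_comb i a x y z /\
           r = << z >> - (a *: << x >> + << y >>)].

(** [V^{(x) n}]: the free vector space on [n]-tuples modulo multilinearity in
    each slot. *)
Definition tpow n : lmodType K := lquot (lspan (@tensor_rel n)).

Definition tens n (x : n.-tuple V) : tpow n := lpi (lspan (@tensor_rel n)) << x >>.

Lemma tens_multilinear n : multilinear (@tens n).
Proof.
move=> i a x y z xyz; rewrite /tens -linearP; apply/lpi_eqP => A [_]; apply.
by exists i, a, x, y, z.
Qed.

(** Meaningful for multilinear [f]: see [tlift_is_linear] and [tlift_tens]. *)
Definition tlift n (W : lmodType K) (f : n.-tuple V -> W) : tpow n -> W :=
  qlift (malg_lift f).

Lemma malg_lift_rel n (W : lmodType K) (f : n.-tuple V -> W) : multilinear f ->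
  forall r, subspace_set (lspan (@tensor_rel n)) r -> malg_lift f r = 0.
Proof.
move=> fP; apply: lspan_ker => _ [i [a [x [y [z [xyz ->]]]]]].
by rewrite linearB linearP /= !malg_liftU (fP _ _ _ _ _ xyz) subrr.
Qed.

Lemma tlift_is_linear n (W : lmodType K) (f : n.-tuple V -> W) :
  multilinear f -> linear (tlift f).
Proof. by move=> fP; apply: qlift_is_linear; apply: malg_lift_rel. Qed.

Lemma tlift_tens n (W : lmodType K) (f : n.-tuple V -> W) :
  multilinear f -> forall x, tlift f (tens x) = f x.
Proof.
move=> fP x; rewrite -(malg_liftU f x).
exact: (qliftE (f := malg_lift f) (malg_lift_rel fP)).
Qed.

Lemma tpow_ext n (W : lmodType K) (f g : tpow n -> W) :
  linear f -> linear g -> (forall x, f (tens x) = g (tens x)) -> f =1 g.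
Proof.
move=> fL gL fg z; have [p ->] := lpi_surj z.
pose fm := GRing.isLinear.Build K (tpow n) W *:%R f fL.
pose gm := GRing.isLinear.Build K (tpow n) W *:%R g gL.
pose F : {linear tpow n -> W} := HB.pack f fm.
pose G : {linear tpow n -> W} := HB.pack g gm.
rewrite -[f]/(F : _ -> _) -[g]/(G : _ -> _) [p]monalgE !linear_sum.
apply: eq_bigr => x _.
have -> : << p@_x *g x >> = p@_x *: << x >> :> {malg K[n.-tuple V]}.
  by apply/malgP => k; rewrite mcoeffZ !mcoeffU mulrnAr mulr1.
by rewrite !linearZ /=; congr (_ *: _); apply: fg.
Qed.

Definition tcat p q (s : tpow p) (t : tpow q) : tpow (p + q) :=
  tlift (fun x : p.-tuple V =>
    tlift (fun y : q.-tuple V => tens [tuple of x ++ y]) t) s.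

Lemma cat_multilinearr p q (x : p.-tuple V) :
  multilinear (fun y : q.-tuple V => tens [tuple of x ++ y]).
Proof.
move=> i a y y' z [yz zi]; apply: (@tens_multilinear _ (rshift p i) a).
split=> [k|]; last by rewrite !tnth_rshift.
case: (split_ordP k) => j ->; first by rewrite !tnth_lshift.
by rewrite !tnth_rshift eq_rshift; apply: yz.
Qed.

Lemma cat_multilinearl p q (t : tpow q) :
  multilinear (fun x : p.-tuple V =>
    tlift (fun y : q.-tuple V => tens [tuple of x ++ y]) t).
Proof.
move=> i a x x' z [xz zi]; move: t.
have L (w : p.-tuple V) := tlift_is_linear (@cat_multilinearr p q w).
apply: tpow_ext => [|b s t|y]; first exact: L.
  by rewrite (L x b s t) (L x' b s t); apply: lin_interchange.
have T (w : p.-tuple V) := tlift_tens (@cat_multilinearr p q w) y.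
rewrite (T z) (T x) (T x'); apply: (@tens_multilinear _ (lshift q i) a).
split=> [k|]; last by rewrite !tnth_lshift.
case: (split_ordP k) => j ->; last by rewrite !tnth_rshift.
by rewrite !tnth_lshift eq_lshift; apply: xz.
Qed.

Lemma tcat_is_bilinear p q :
  bilinear_for *:%R *:%R (@tcat p q : tpow p -> tpow q -> tpow (p + q)).
Proof.
split=> [t|s]; first by apply: tlift_is_linear; apply: cat_multilinearl.
move=> a t t'; move: s; apply: tpow_ext.
- by apply: tlift_is_linear; apply: cat_multilinearl.
- move=> b s s'.
  have L (r : tpow q) : tcat (b *: s + s') r = b *: tcat s r + tcat s' r.
    exact: (tlift_is_linear (@cat_multilinearl p q r) b s s').
  by rewrite (L t) (L t'); apply: lin_interchange.
- move=> x; have T (r : tpow q) :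
      tcat (tens x) r = tlift (fun y : q.-tuple V => tens [tuple of x ++ y]) r.
    exact: (tlift_tens (@cat_multilinearl p q r) x).
  by rewrite !T; apply: (tlift_is_linear (@cat_multilinearr p q x) a t t').
Qed.

HB.instance Definition _ p q := bilinear_isBilinear.Build K
  (tpow p) (tpow q) (tpow (p + q)) *:%R *:%R (@tcat p q) (@tcat_is_bilinear p q).

Lemma tcat_tens p q (x : p.-tuple V) (y : q.-tuple V) :
  tcat (tens x) (tens y) = tens [tuple of x ++ y].
Proof.
rewrite /tcat (tlift_tens (@cat_multilinearl p q _) x).
exact: (tlift_tens (@cat_multilinearr p q x)).
Qed.

Definition tmap n (f : V -> V) : tpow n -> tpow n :=
  tlift (fun x => tens [tuple of map f x]).

Lemma tmap_multilinear n (f : {linear V -> V}) :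
  multilinear (fun x : n.-tuple V => tens [tuple of map f x]).
Proof.
move=> i a x y z [xz zi]; apply: (@tens_multilinear _ i a).
split=> [k ki|]; last by rewrite !tnth_map zi linearP.
by have [h1 h2] := xz k ki; rewrite !tnth_map h1 h2.
Qed.

Lemma tmap_is_linear n (f : {linear V -> V}) : linear (@tmap n f).
Proof. by apply: tlift_is_linear; apply: tmap_multilinear. Qed.

HB.instance Definition _ n (f : {linear V -> V}) := GRing.isLinear.Build K
  (tpow n) (tpow n) *:%R (@tmap n f) (@tmap_is_linear n f).

Lemma tmap_tens n (f : {linear V -> V}) (x : n.-tuple V) :
  tmap f (tens x) = tens [tuple of map f x].
Proof. by rewrite /tmap tlift_tens //; apply: tmap_multilinear. Qed.

End TensorPower.

Record homNAlg (K : fieldType) := HomNAlg {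
  hna_sort :> lmodType K;
  hna_mul : {bilinear hna_sort -> hna_sort -> hna_sort};
  hna_twist : {linear hna_sort -> hna_sort};
  hna_twistM : forall x y,
    hna_twist (hna_mul x y) = hna_mul (hna_twist x) (hna_twist y) }.

Record homLieDer (K : fieldType) := HomLieDer {
  hld_sort :> lmodType K;
  hld_bracket : {bilinear hld_sort -> hld_sort -> hld_sort};
  hld_twist : {linear hld_sort -> hld_sort};
  hld_der : {linear hld_sort -> hld_sort};
  hld_skew : forall x y, hld_bracket x y = - hld_bracket y x;
  hld_jacobi : forall x y z,
    hld_bracket (hld_twist x) (hld_bracket y z) +
    hld_bracket (hld_twist y) (hld_bracket z x) +
    hld_bracket (hld_twist z) (hld_bracket x y) = 0;
  hld_twistM : forall x y,
    hld_twist (hld_bracket x y) = hld_bracket (hld_twist x) (hld_twist y);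
  hld_der_twist : forall x, hld_der (hld_twist x) = hld_twist (hld_der x);
  hld_derM : forall x y,
    hld_der (hld_bracket x y) =
    hld_bracket (hld_der x) (hld_twist y) +
    hld_bracket (hld_twist x) (hld_der y) }.

(** Weighted trees with any number of leaves: the set of weighted [n]-trees is
    [[set t | nleaves t = n]].  [wnode w l r] has a root of weight [w]. *)
Inductive wtree := wleaf | wnode of nat & wtree & wtree.

Fixpoint nleaves (t : wtree) : nat :=
  if t is wnode _ l r then (nleaves l + nleaves r)%N else 1%N.

Definition wjoin (t s : wtree) : wtree := wnode 0 t s.

(** [t[1]]; only meaningful for trees with at least two leaves. *)
Definition wincr (t : wtree) : wtree :=
  if t is wnode w l r then wnode w.+1 l r else wleaf.

Section TreeModule.
Variables (K : fieldType) (V : lmodType K) (alpha : {linear V -> V}).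

Definition treemod : lmodType K := dsum (fun t : wtree => tpow V (nleaves t)).

(** [(x_1 (x) ... (x) x_n)_t], in the summand indexed by [t] *)
Definition elt (t : wtree) (x : (nleaves t).-tuple V) : treemod :=
  dsum_in (M := fun t => tpow V (nleaves t)) (t := t) (tens x).

(** Components of the product: [t = l \/ r] exactly when [t = wnode 0 l r];
    [treemul_elt] below gives the value on the spanning elements. *)
Definition treemul_fun (u v : treemod) (t : wtree) : tpow V (nleaves t) :=
  match t with
  | wnode 0 l r => tcat (u l) (v r)
  | _ => 0
  end.

(** Components of the twisting map: [t = s[1]] exactly when [t = wnode w.+1 l r]
    and [s = wnode w l r]; see [treetwist_leaf] and [treetwist_node] for the
    values on the spanning elements. *)
Definition treetwist_fun (u : treemod) (t : wtree) : tpow V (nleaves t) :=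
  match t with
  | wleaf => tmap alpha (u wleaf)
  | wnode 0 _ _ => 0
  | wnode w.+1 l r => u (wnode w l r)
  end.

Lemma treemul_fin u v : finite_set [set t | treemul_fun u v t != 0].
Proof.
apply: sub_finite_set (finite_image2 wjoin (dsum_fin u) (dsum_fin v)).
move=> [|[|w] l r] /=; rewrite ?eqxx // => uv.
exists l => /=.
  by apply: contra_neq uv => ->; rewrite linear0l.
exists r => //=.
by apply: contra_neq uv => ->; rewrite linear0r.
Qed.

Lemma treetwist_fin u : finite_set [set t | treetwist_fun u t != 0].
Proof.
apply: sub_finite_set (finite_image wincr (dsum_fin u)).
move=> [|[|w] l r] /=; rewrite ?eqxx // => ut; last by exists (wnode w l r).
exists wleaf.
  apply: contra_neq ut => ->.
  exact: (linear0 (tmap (n:=1) alpha)).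
by [].
Qed.

Definition treemul u v : treemod := DSum (treemul_fin u v).
Definition treetwist u : treemod := DSum (treetwist_fin u).

Lemma treemul_is_bilinear :
  bilinear_for *:%R *:%R (treemul : treemod -> treemod -> treemod).
Proof.
split=> [v|u] a x y; apply/dsumP => -[|[|w] l r] /=; rewrite ?scaler0 ?addr0 //.
  exact: linearPl.
exact: linearPr.
Qed.

HB.instance Definition _ := bilinear_isBilinear.Build K
  treemod treemod treemod *:%R *:%R treemul treemul_is_bilinear.

Lemma treetwist_is_linear : linear treetwist.
Proof.
move=> a x y; apply/dsumP => -[|[|w] l r] /=; rewrite ?scaler0 ?addr0 //.
exact: linearP.
Qed.

HB.instance Definition _ :=
  GRing.isLinear.Build K treemod treemod *:%R treetwist treetwist_is_linear.

Lemma elt_eq t (x : (nleaves t).-tuple V) : elt x t = tens x.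
Proof. exact: (dsum_in_eq (M := fun t => tpow V (nleaves t))). Qed.

Lemma elt_neq t s (x : (nleaves t).-tuple V) : t <> s -> elt x s = 0.
Proof. exact: (dsum_in_neq (M := fun t => tpow V (nleaves t))). Qed.

Lemma elt_multilinear t : multilinear (@elt t).
Proof.
move=> i a x y z /tens_multilinear xyz.
by rewrite /elt xyz (linearP (@dsum_in _ _ (fun t => tpow V (nleaves t)) t)).
Qed.

Lemma treemul_elt t s (x : (nleaves t).-tuple V) (y : (nleaves s).-tuple V) :
  treemul (elt x) (elt y) = elt (t := wjoin t s) [tuple of x ++ y].
Proof.
apply/dsumP => r; have [<-|tsr] := pselect (wjoin t s = r).
  rewrite elt_eq; transitivity (tcat (elt x t) (elt y s)) => //.
  by rewrite !elt_eq tcat_tens.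
rewrite (elt_neq _ tsr); case: r tsr => [|[|w] l r] // tsr.
transitivity (tcat (elt x l) (elt y r)) => //.
have [tl|tl] := pselect (t = l); last by rewrite (elt_neq _ tl) linear0l.
have [sr|sr] := pselect (s = r); first by rewrite tl sr in tsr.
by rewrite (elt_neq _ sr) linear0r.
Qed.

Lemma treetwist_leaf (x : 1.-tuple V) :
  treetwist (elt (t := wleaf) x) = elt (t := wleaf) [tuple of map alpha x].
Proof.
apply/dsumP => -[|w l r].
  rewrite elt_eq; transitivity (tmap alpha (elt (t := wleaf) x wleaf)) => //.
  by rewrite elt_eq tmap_tens.
rewrite (elt_neq (t := wleaf)) //; case: w => [//|w].
exact: (@elt_neq wleaf (wnode w l r) x).
Qed.

Lemma treetwist_node w l r (x : (nleaves l + nleaves r).-tuple V) :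
  treetwist (elt (t := wnode w l r) x) = elt (t := wnode w.+1 l r) x.
Proof.
apply/dsumP => -[|[|w'] l' r'].
- rewrite [RHS]elt_neq //.
  transitivity (tmap alpha (elt (t := wnode w l r) x wleaf)) => //.
  by rewrite elt_neq // (linear0 (tmap (n := 1) alpha)).
- by rewrite [RHS]elt_neq.
change (elt (t := wnode w l r) x (wnode w' l' r') =
  elt (t := wnode w.+1 l r) x (wnode w'.+1 l' r') :> tpow V (nleaves l' + nleaves r')).
have [[ww ll rr]|ne] := pselect (wnode w l r = wnode w' l' r').
  by case: _ / ww; case: _ / ll; case: _ / rr; rewrite !elt_eq.
rewrite [RHS](elt_neq (t := wnode w.+1 l r)); first exact: (@elt_neq (wnode w l r) (wnode w' l' r') x ne).
by move=> [ww ll rr]; apply: ne; rewrite ww ll rr.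
Qed.

Definition two_sided_ideal (I : set treemod) : Prop :=
  is_subspace I /\ forall x y, I x -> I (treemul x y) /\ I (treemul y x).

Definition ideal_gen (S : set treemod) : set treemod := smallest two_sided_ideal S.

(** Indexed from [0]: [mult_ideal n] is the ideal [M_{n+1}]. *)
Fixpoint mult_ideal (n : nat) : set treemod :=
  if n is m.+1 then ideal_gen (mult_ideal m `|` treetwist @` mult_ideal m)
  else ideal_gen [set r | exists u v,
    r = treetwist (treemul u v) - treemul (treetwist u) (treetwist v)].

Definition mult_ideal_oo : set treemod := \bigcup_n mult_ideal n.

Lemma ideal_gen_ideal S : two_sided_ideal (ideal_gen S).
Proof.
split; first split.
- by move=> A [[[]]].
- move=> a x y Sx Sy A hA; have [[[_ h] _] _] := hA.
  by apply: h; [apply: Sx|apply: Sy].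
- by move=> x y Sx; split=> A hA; have [[_ h] _] := hA;
    have [] := h x y (Sx A hA).
Qed.

Lemma mult_ideal_ideal n : two_sided_ideal (mult_ideal n).
Proof. by case: n => [|n]; apply: ideal_gen_ideal. Qed.

Lemma mult_ideal_twist n x : mult_ideal n x -> mult_ideal n.+1 (treetwist x).
Proof. by move=> nx A [_]; apply; right; exists x. Qed.

Lemma mult_ideal_le m n : (m <= n)%N -> mult_ideal m `<=` mult_ideal n.
Proof.
move=> /subnK <-; elim: (n - m)%N => [|k IH] // x /IH kx.
by rewrite addSn => A [_]; apply; left.
Qed.

Lemma mult_ideal_oo_ideal : two_sided_ideal mult_ideal_oo.
Proof.
split; first split.
- by exists 0%N => //; have [[]] := mult_ideal_ideal 0.
- move=> a x y [m _ mx] [n _ ny]; exists (maxn m n) => //.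
  have [[_ h] _] := mult_ideal_ideal (maxn m n).
  by apply: h; [apply: mult_ideal_le mx|apply: mult_ideal_le ny];
    rewrite ?leq_maxl ?leq_maxr.
- move=> x y [m _ mx]; have [_ h] := mult_ideal_ideal m.
  by have [h1 h2] := h x y mx; split; exists m.
Qed.

Definition mult_ideal_sub : subspace treemod :=
  Subspace (proj1 mult_ideal_oo_ideal).

Definition free_hmod : lmodType K := lquot mult_ideal_sub.

Definition fpi : {linear treemod -> free_hmod} := lpi mult_ideal_sub.

Definition free_mul (x y : free_hmod) : free_hmod :=
  fpi (treemul (lrepr x) (lrepr y)).

Definition free_twist (x : free_hmod) : free_hmod := fpi (treetwist (lrepr x)).

Lemma fpi_surj x : exists u, x = fpi u.
Proof. exact: lpi_surj. Qed.

Lemma fpi_eqP u v : fpi u = fpi v <-> mult_ideal_oo (u - v).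
Proof. exact: lpi_eqP. Qed.

Lemma free_mulE u v : free_mul (fpi u) (fpi v) = fpi (treemul u v).
Proof.
have [[_ ID] IM] := mult_ideal_oo_ideal.
have h w : mult_ideal_oo (lrepr (fpi w) - w).
  by apply/fpi_eqP; apply: (lreprK (fpi w)).
apply/fpi_eqP.
set u' := lrepr _; set v' := lrepr _.
have -> : treemul u' v' - treemul u v =
          1 *: treemul (u' - u) v' + treemul u (v' - v).
  by rewrite scale1r linearBl linearBr addrA subrK.
by apply: ID; [have [] := IM _ v' (h u)|have [] := IM _ u (h v)].
Qed.

Lemma free_twistE u : free_twist (fpi u) = fpi (treetwist u).
Proof.
apply/fpi_eqP; rewrite -linearB.
have [n _ nu] : mult_ideal_oo (lrepr (fpi u) - u).
  by apply/fpi_eqP; apply: (lreprK (fpi u)).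
by exists n.+1 => //; apply: mult_ideal_twist.
Qed.

Lemma free_mul_is_bilinear :
  bilinear_for *:%R *:%R (free_mul : free_hmod -> free_hmod -> free_hmod).
Proof.
split=> [z|z] a x y; have [w ->] := fpi_surj z; have [u ->] := fpi_surj x;
  have [v ->] := fpi_surj y; rewrite -linearP !free_mulE.
  by rewrite linearPl linearP.
by rewrite linearPr linearP.
Qed.

HB.instance Definition _ := bilinear_isBilinear.Build K
  free_hmod free_hmod free_hmod *:%R *:%R free_mul free_mul_is_bilinear.

Lemma free_twist_is_linear : linear free_twist.
Proof.
move=> a x y; have [u ->] := fpi_surj x; have [v ->] := fpi_surj y.
by rewrite -linearP !free_twistE !linearP.
Qed.

HB.instance Definition _ :=
  GRing.isLinear.Build K free_hmod free_hmod *:%R free_twist free_twist_is_linear.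

Lemma free_twistM x y :
  free_twist (free_mul x y) = free_mul (free_twist x) (free_twist y).
Proof.
have [u ->] := fpi_surj x; have [v ->] := fpi_surj y.
rewrite free_mulE !free_twistE free_mulE; apply/fpi_eqP.
by exists 0%N => // A [_]; apply; exists u, v.
Qed.

Definition free_homNAlg : homNAlg K :=
  @HomNAlg K free_hmod free_mul free_twist free_twistM.

Definition free_inj (x : V) : free_homNAlg := fpi (elt (t := wleaf) [tuple x]).

Lemma free_inj_is_linear : linear free_inj.
Proof.
move=> a x y; rewrite /free_inj -linearP; congr (fpi _).
apply: (@elt_multilinear wleaf ord0); split=> [k|]; first by rewrite ord1.
by rewrite !(tnth_nth 0).
Qed.

HB.instance Definition _ :=
  GRing.isLinear.Build K V free_homNAlg *:%R free_inj free_inj_is_linear.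

Lemma free_inj_twist x : free_inj (alpha x) = hna_twist free_homNAlg (free_inj x).
Proof.
transitivity (fpi (treetwist (elt (t := wleaf) [tuple x]))).
  by rewrite treetwist_leaf /free_inj; congr (fpi (elt _)); apply/val_inj.
by rewrite -free_twistE.
Qed.

End TreeModule.

(* Main.v *)
(** The derivations of a Hom-nonassociative algebra [F] of the kind in the
    statement are the second components of the morphisms [x |-> (x, dhat x)]
    into [F x F] with product [(x,u)(y,v) = (xy, u a(y) + a(x) v)] and twisting
    map [a x a]: the analogue of the dual numbers over [F].  For [F] free, such
    morphisms correspond to Hom-module morphisms on the generators, here
    [x |-> (j x, j (d x))]. *)

From HB Require Import structures.
Require Import Defs.
From mathcomp Require Import all_boot all_algebra.
From mathcomp Require Import sesquilinear.
From mathcomp Require Import boolp classical_sets functions cardinality finmap.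

Set Implicit Arguments.
Unset Strict Implicit.
Unset Printing Implicit Defensive.

Import GRing.Theory.
Local Open Scope ring_scope.

(** * Linear maps out of a direct sum *)

Section DirectSumLift.
Variables (K : fieldType) (T : Type) (M : T -> lmodType K) (W : lmodType K).

(** [{classic T}] gives the arbitrary index type the choice structure that finite sets require. The
    default value of [fset_set] on infinite sets is excluded by [dsum_fin]. *)
Definition dsum_supp (u : dsum M) : {fset {classic T}} :=
  fset_set [set t : {classic T} | u t != 0]%classic.

Lemma mem_dsum_supp (u : dsum M) (t : {classic T}) :
  (t \in dsum_supp u) = (u t != 0).
Proof.
by rewrite /dsum_supp in_fset_set ?mem_setE //; apply: dsum_fin.
Qed.

Section Lift.
Variable f : forall t, {linear M t -> W}.

Definition dsum_lift (u : dsum M) : W := \sum_(t <- dsum_supp u) f t (u t).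

(** Terms off the support vanish, so the lifts of several vectors can be compared over one common
    index set. *)
Lemma dsum_lift_wide (u : dsum M) (D : {fset {classic T}}) :
  fsubset (dsum_supp u) D -> dsum_lift u = \sum_(t <- D) f t (u t).
Proof.
move=> uD; apply: big_fset_incl => // t _.
by rewrite mem_dsum_supp negbK => /eqP ->; rewrite linear0.
Qed.

Lemma dsum_lift_is_linear : linear dsum_lift.
Proof.
move=> a u v.
pose D := fsetU (dsum_supp (a *: u + v)) (fsetU (dsum_supp u) (dsum_supp v)).
rewrite !(@dsum_lift_wide _ D); last 3 first.
- by apply: fsubset_trans (fsubsetUr _ _); apply: fsubsetUr.
- by apply: fsubset_trans (fsubsetUr _ _); apply: fsubsetUl.
- exact: fsubsetUl.
rewrite scaler_sumr -big_split; apply: eq_bigr => t _ /=.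
exact: linearP.
Qed.

Lemma dsum_lift_in t (x : M t) : dsum_lift (dsum_in x) = f t x.
Proof.
rewrite (@dsum_lift_wide _ (fset1 (t : {classic T}))).
  by rewrite big_seq_fset1 dsum_in_eq.
apply/fsubsetP => s; rewrite mem_dsum_supp in_fset1.
by apply: contra_neqT => /eqP ts; rewrite dsum_in_neq // => /esym.
Qed.

End Lift.

Lemma dsum_sum (u : dsum M) : u = \sum_(t <- dsum_supp u) dsum_in (u t).
Proof.
apply/dsumP => s.
have evalD (r : seq {classic T}) :
    (\sum_(t <- r) dsum_in (u t)) s = \sum_(t <- r) dsum_in (u t) s.
  elim: r => [|t r IH]; first by rewrite !big_nil.
  by rewrite !big_cons -IH.
(* On the support only the term of index [s] survives evaluation at [s]; off it both sides are
   zero. *)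
rewrite evalD; have [us|us] := boolP ((s : {classic T}) \in dsum_supp u).
  rewrite (big_fsetD1 (s : {classic T})) // big1_seq.
    by rewrite [RHS]addr0 dsum_in_eq.
  move=> t /andP[_]; rewrite in_fsetD1 => /andP[/eqP ts _].
  by rewrite dsum_in_neq.
rewrite big1_seq => [|t /andP[_ ut]].
  by move: us; rewrite mem_dsum_supp negbK => /eqP.
by rewrite dsum_in_neq // => ts; move: us; rewrite -ts ut.
Qed.

Lemma dsum_ext (f g : {linear dsum M -> W}) :
  (forall t (x : M t), f (dsum_in x) = g (dsum_in x)) -> f =1 g.
Proof.
move=> fg u; rewrite [u]dsum_sum !linear_sum.
by apply: eq_bigr => t _; apply: fg.
Qed.

End DirectSumLift.

Section TreeExt.
Variables (K : fieldType) (V : lmodType K) (W : lmodType K).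

(** The elements [elt x] span: [dsum_ext] reduces to one summand, [tpow_ext] to pure tensors inside
    it. *)
Lemma treemod_ext (f g : {linear treemod V -> W}) :
  (forall t (x : (nleaves t).-tuple V), f (elt x) = g (elt x)) -> f =1 g.
Proof.
move=> fg; apply: dsum_ext => t; apply: tpow_ext => [a x y|a x y|x].
- by rewrite !linearP.
- by rewrite !linearP.
exact: fg.
Qed.

End TreeExt.

(** * The universal property of the free Hom-nonassociative algebra *)

Section Universal.
Variables (K : fieldType) (V : lmodType K) (alpha : {linear V -> V}).

Definition homNAlg_morph (A B : homNAlg K) (h : A -> B) : Prop :=
  [/\ linear h,
      forall x, h (hna_twist A x) = hna_twist B (h x) &
      forall x y, h (hna_mul A x y) = hna_mul B (h x) (h y)].

(** Indexing through [lshift] gives the length [p] on the nose, where [take] would give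
    [minn p (p + q)]. *)
Definition tuple_fst p q (x : (p + q).-tuple V) : p.-tuple V :=
  [tuple tnth x (lshift q i) | i < p].

Definition tuple_snd p q (x : (p + q).-tuple V) : q.-tuple V :=
  [tuple tnth x (rshift p i) | i < q].

Lemma tuple_fst_cat p q (x : p.-tuple V) (y : q.-tuple V) :
  tuple_fst [tuple of x ++ y] = x.
Proof. by apply: eq_from_tnth => i; rewrite tnth_mktuple tnth_lshift. Qed.

Lemma tuple_snd_cat p q (x : p.-tuple V) (y : q.-tuple V) :
  tuple_snd [tuple of x ++ y] = y.
Proof. by apply: eq_from_tnth => i; rewrite tnth_mktuple tnth_rshift. Qed.

Lemma tuple_fst_snd p q (x : (p + q).-tuple V) :
  [tuple of tuple_fst x ++ tuple_snd x] = x.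
Proof.
apply: eq_from_tnth => k; case: (split_ordP k) => i ->.
  by rewrite tnth_lshift tnth_mktuple.
by rewrite tnth_rshift tnth_mktuple.
Qed.

Lemma elt_leaf (x : 1.-tuple V) :
  elt (t := wleaf) x = elt (t := wleaf) [tuple thead x].
Proof.
by rewrite [x in LHS]tuple_eta; congr elt; apply/val_inj; case: x => -[|? []].
Qed.

(** A join creates a root of weight 0 and each twist adds 1 to it. Hence pure tensors are generated
    by the leaves under product and twist. *)
Lemma elt_node w l r (x : (nleaves l + nleaves r).-tuple V) :
  elt (t := wnode w l r) x =
  iter w (treetwist alpha) (treemul (elt (tuple_fst x)) (elt (tuple_snd x))).
Proof.
elim: w => [|w IH]; first by rewrite treemul_elt tuple_fst_snd.
by rewrite iterS -IH treetwist_node.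
Qed.

Notation F := (free_homNAlg alpha).

Lemma fpi_iter_twist w u :
  fpi alpha (iter w (treetwist alpha) u) = iter w (hna_twist F) (fpi alpha u).
Proof. by elim: w => //= w <-; rewrite -free_twistE. Qed.

(** * Uniqueness of the extension of a map given on generators *)

Section Uniqueness.
Variables (A : homNAlg K) (h k : F -> A).
Hypotheses (hP : homNAlg_morph h) (kP : homNAlg_morph k).
Hypothesis hkj : forall x, h (free_inj alpha x) = k (free_inj alpha x).

Lemma free_ext_elt t (x : (nleaves t).-tuple V) :
  h (fpi alpha (elt x)) = k (fpi alpha (elt x)).
Proof.
have [_ hT hM] := hP; have [_ kT kM] := kP.
elim: t x => [|w l IHl r IHr] x; first by rewrite elt_leaf; apply: hkj.
rewrite elt_node fpi_iter_twist -free_mulE.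
(* Induction on the root weight moves the twists through [h] and [k], leaving a product of two
   smaller trees. *)
elim: w {x} (tuple_fst x) (tuple_snd x) => [|w IH] y z /=;
  last by rewrite hT kT IH.
by rewrite hM kM IHl IHr.
Qed.

Lemma free_ext : h =1 k.
Proof.
have [hL _ _] := hP; have [kL _ _] := kP.
have hfL : linear (h \o fpi alpha).
  by move=> a u v; rewrite /= linearP; apply: hL.
have kfL : linear (k \o fpi alpha).
  by move=> a u v; rewrite /= linearP; apply: kL.
pose hf : {linear treemod V -> A} :=
  HB.pack (h \o fpi alpha) (GRing.isLinear.Build _ _ _ _ _ hfL).
pose kf : {linear treemod V -> A} :=
  HB.pack (k \o fpi alpha) (GRing.isLinear.Build _ _ _ _ _ kfL).
move=> x; have [u ->] := fpi_surj x.
by apply: (@treemod_ext _ _ _ hf kf) => t y; apply: free_ext_elt.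
Qed.

End Uniqueness.

(** * Existence of the extension, by evaluating trees in [A] *)

Section Existence.
Variables (A : homNAlg K) (f : {linear V -> A}).
Hypothesis f_twist : forall x, f (alpha x) = hna_twist A (f x).

(** By [elt_node], any morphism extending [f] must take this value on the class of [elt x]. *)
Fixpoint tree_eval (t : wtree) : (nleaves t).-tuple V -> A :=
  match t return (nleaves t).-tuple V -> A with
  | wleaf => fun x => f (thead x)
  | wnode w l r => fun x => iter w (hna_twist A)
      (hna_mul A (tree_eval (tuple_fst x)) (tree_eval (tuple_snd x)))
  end.

Lemma iter_twist_is_linear w : linear (iter w (hna_twist A)).
Proof. by move=> a x y; elim: w => //= w ->; rewrite linearP. Qed.

(** The varying slot lies in one of the two subtrees, and the tuple of the other is common to [x],
    [y] and [z]. The product is then linear in the varying factor, and so is the iterated twist. *)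
Lemma tree_eval_multilinear t : multilinear (@tree_eval t).
Proof.
elim: t => [|w l IHl r IHr] i a x y z [xyz zi] /=.
  by move: zi; rewrite (ord1 i) /thead => ->; rewrite linearP.
rewrite -iter_twist_is_linear; congr iter.
case: (split_ordP i) xyz zi => j -> xyz zi.
- have sx : tuple_snd x = tuple_snd z.
    apply: eq_from_tnth => k; rewrite !tnth_mktuple.
    by have [] := xyz (rshift _ k); rewrite ?eq_rlshift.
  have sy : tuple_snd y = tuple_snd z.
    apply: eq_from_tnth => k; rewrite !tnth_mktuple.
    by have [] := xyz (rshift _ k); rewrite ?eq_rlshift.
  rewrite sx sy (IHl j a (tuple_fst x) (tuple_fst y)) ?linearPl //.
  split=> [k kj|]; rewrite !tnth_mktuple //.
  by apply: xyz; rewrite eq_lshift.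
- have sx : tuple_fst x = tuple_fst z.
    apply: eq_from_tnth => k; rewrite !tnth_mktuple.
    by have [] := xyz (lshift _ k); rewrite ?eq_lrshift.
  have sy : tuple_fst y = tuple_fst z.
    apply: eq_from_tnth => k; rewrite !tnth_mktuple.
    by have [] := xyz (lshift _ k); rewrite ?eq_lrshift.
  rewrite sx sy (IHr j a (tuple_snd x) (tuple_snd y)) ?linearPr //.
  split=> [k kj|]; rewrite !tnth_mktuple //.
  by apply: xyz; rewrite eq_rshift.
Qed.

Definition tpow_eval t : tpow V (nleaves t) -> A := tlift (@tree_eval t).

HB.instance Definition _ t := GRing.isLinear.Build K _ _ _ (@tpow_eval t)
  (tlift_is_linear (@tree_eval_multilinear t)).

Definition treemod_eval : treemod V -> A :=
  dsum_lift (M := fun t => tpow V (nleaves t)) tpow_eval.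

HB.instance Definition _ := GRing.isLinear.Build K _ _ _ treemod_eval
  (dsum_lift_is_linear (M := fun t => tpow V (nleaves t)) tpow_eval).

Lemma treemod_eval_elt t (x : (nleaves t).-tuple V) :
  treemod_eval (elt x) = tree_eval x.
Proof.
rewrite /treemod_eval /elt.
rewrite (dsum_lift_in (M := fun t => tpow V (nleaves t)) tpow_eval).
exact: tlift_tens (@tree_eval_multilinear t) x.
Qed.

(** On a leaf this is [f_twist]; on a node, raising the weight by 1 adds one iterate of the twist of
    [A]. *)
Lemma treemod_eval_twist u :
  treemod_eval (treetwist alpha u) = hna_twist A (treemod_eval u).
Proof.
apply: (treemod_ext (f := treemod_eval \o treetwist alpha)
                    (g := hna_twist A \o treemod_eval)) u => -[|w l r] x /=.
  rewrite treetwist_leaf !treemod_eval_elt /= -f_twist; congr (f _).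
  by rewrite /thead tnth_map.
by rewrite treetwist_node !treemod_eval_elt.
Qed.

Lemma treemod_eval_mul u v :
  treemod_eval (treemul u v) = hna_mul A (treemod_eval u) (treemod_eval v).
Proof.
have mulL w : linear (fun u => treemod_eval (treemul u w)).
  by move=> a x y; rewrite linearPl linearP.
have mulR w : linear (fun u => treemod_eval (treemul w u)).
  by move=> a x y; rewrite linearPr linearP.
have mulAL (b : A) : linear (fun u => hna_mul A (treemod_eval u) b).
  by move=> a x y; rewrite linearP linearPl.
have mulAR (b : A) : linear (fun u => hna_mul A b (treemod_eval u)).
  by move=> a x y; rewrite linearP linearPr.
pose L w : {linear treemod V -> A} :=
  HB.pack (fun u => treemod_eval (treemul u w))
  (GRing.isLinear.Build _ _ _ _ _ (mulL w)).
pose R w : {linear treemod V -> A} :=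
  HB.pack (fun u => treemod_eval (treemul w u))
  (GRing.isLinear.Build _ _ _ _ _ (mulR w)).
pose AL b : {linear treemod V -> A} :=
  HB.pack (fun u => hna_mul A (treemod_eval u) b)
  (GRing.isLinear.Build _ _ _ _ _ (mulAL b)).
pose AR b : {linear treemod V -> A} :=
  HB.pack (fun u => hna_mul A b (treemod_eval u))
  (GRing.isLinear.Build _ _ _ _ _ (mulAR b)).
(* Both sides are linear in each argument, so [u] and then [v] may be taken to be pure tensors. *)
apply: (treemod_ext (f := L v) (g := AL (treemod_eval v))) u => t x.
apply: (treemod_ext (f := R (elt x)) (g := AR (treemod_eval (elt x)))) v.
move=> s y /=.
rewrite treemul_elt !treemod_eval_elt.
(* The root of a join has weight 0, so [tree_eval] is the bare product there. *)
by rewrite -[LHS]/(hna_mul A _ _) tuple_fst_cat tuple_snd_cat.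
Qed.

(** The kernel is a two-sided ideal, so only generators need checking: those of the first ideal die
    because the twist of [A] is multiplicative, the later ones because the kernel is stable under
    the twist. *)
Lemma treemod_eval_ideal n u : mult_ideal alpha n u -> treemod_eval u = 0.
Proof.
have kerI : two_sided_ideal [set u | treemod_eval u = 0]%classic.
  split; first split=> [|a x y /= x0 y0]; first exact: linear0.
    by rewrite linearP /= x0 y0 scaler0 addr0.
  by move=> x y /= x0; rewrite !treemod_eval_mul x0 linear0l linear0r.
elim: n u => [|n IH] u /=; apply: (smallest_sub kerI).
  move=> _ [x [y ->]] /=.
  rewrite linearB /= treemod_eval_twist !treemod_eval_mul.
  by rewrite hna_twistM !treemod_eval_twist subrr.
move=> x [/IH //|[y /IH y0 <-]] /=.
by rewrite treemod_eval_twist y0 linear0.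
Qed.

Lemma free_lift_ex :
  exists h : F -> A, homNAlg_morph h /\ forall x, h (free_inj alpha x) = f x.
Proof.
have ev0 u : subspace_set (mult_ideal_sub alpha) u -> treemod_eval u = 0.
  by move=> [n _]; apply: treemod_eval_ideal.
pose h : F -> A := qlift treemod_eval.
have hE u : h (fpi alpha u) = treemod_eval u by apply: qliftE ev0 u.
exists h; split=> [|x]; last by rewrite hE treemod_eval_elt.
split=> [|x|x y]; first exact: qlift_is_linear ev0.
  have [u ->] := fpi_surj x.
  by rewrite [hna_twist F _]free_twistE !hE treemod_eval_twist.
have [u ->] := fpi_surj x; have [v ->] := fpi_surj y.
by rewrite [hna_mul F _ _]free_mulE !hE treemod_eval_mul.
Qed.

End Existence.
End Universal.

(** * The dual numbers over a Hom-nonassociative algebra *)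

Section DualNumbers.
Variables (K : fieldType) (A : homNAlg K).
Local Notation mu := (hna_mul A).
Local Notation tw := (hna_twist A).
Local Notation E := (A * A)%type.

Definition dual_mul (x y : E) : E :=
  (mu x.1 y.1, mu x.2 (tw y.1) + mu (tw x.1) y.2).

Definition dual_twist (x : E) : E := (tw x.1, tw x.2).

Lemma dual_mul_is_bilinear :
  bilinear_for *:%R *:%R (dual_mul : E -> E -> E).
Proof.
split=> z a x y; apply: (congr2 pair) => /=.
- exact: linearPl.
- by rewrite linearP !linearPl scalerDr addrACA.
- exact: linearPr.
- by rewrite linearP !linearPr scalerDr addrACA.
Qed.

HB.instance Definition _ := bilinear_isBilinear.Build K
  E E E *:%R *:%R dual_mul dual_mul_is_bilinear.

Lemma dual_twist_is_linear : linear dual_twist.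
Proof. by move=> a x y; rewrite /dual_twist !linearP. Qed.

HB.instance Definition _ :=
  GRing.isLinear.Build K E E *:%R dual_twist dual_twist_is_linear.

(** Each of the three products occurring in the two components obeys [hna_twistM] in [A]. *)
Lemma dual_twistM x y :
  dual_twist (dual_mul x y) = dual_mul (dual_twist x) (dual_twist y).
Proof. by rewrite /dual_twist /= linearD /= !hna_twistM. Qed.

Definition dual_homNAlg : homNAlg K := HomNAlg dual_twistM.

End DualNumbers.

Theorem proposition3p4 (K : fieldType) (charK : [pchar K] =i pred0)
    (g : homLieDer K) :
  let alpha := hld_twist g in
  let d := hld_der g in
  let F := free_homNAlg alpha in
  let mu := hna_mul F in
  let alpham := hna_twist F in
  let j := free_inj alpha in
  exists! dhat : F -> F,
    [/\ linear dhat,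
        forall x : g, dhat (j x) = j (d x),
        forall x : F, dhat (alpham x) = alpham (dhat x) &
        forall x y : F,
          dhat (mu x y) = mu (dhat x) (alpham y) + mu (alpham x) (dhat y)].
Proof.
move=> alpha d F mu alpham j.
pose jd (x : g) : dual_homNAlg F := (j x, j (d x)).
have jdL : linear jd.
  by move=> a x y; rewrite /jd /j !linearP.
pose f : {linear g -> dual_homNAlg F} :=
  HB.pack jd (GRing.isLinear.Build _ _ _ _ _ jdL).
have [|h [hP hj]] := @free_lift_ex _ _ alpha (dual_homNAlg F) f.
  (* [f] respects the twists: the first component because [j] does, the second because moreover [d]
     commutes with [alpha]. *)
  move=> x; apply: (congr2 pair); first exact: free_inj_twist.
  by rewrite /d hld_der_twist; apply: free_inj_twist.
have [hL hT hM] := hP.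
(* The first projection of the dual numbers is a morphism, so its composite with [h] is an
   endomorphism of [F] fixing the generators, hence the identity. *)
have h1 x : (h x).1 = x.
  apply: (@free_ext _ _ alpha F (fun x => (h x).1) id) => // [|y].
    split=> [a y z|y|y z]; first by rewrite hL.
      by rewrite hT.
    by rewrite hM.
  by rewrite hj.
(* With [h1], the second component of multiplicativity of [h] is the twisted Leibniz rule. *)
exists (fun x => (h x).2); split=> [|k [kL kj kT kM]].
  split=> [a x y|x|x|x y]; first by rewrite hL.
  - by rewrite hj.
  - by rewrite hT.
  - by rewrite hM /= !h1.
apply/funext => x.
(* The conditions on [k] make its graph map a morphism into the dual numbers that agrees with [h] on
   generators. *)
suff -> : h x = (x, k x) by [].
apply: (@free_ext _ _ alpha (dual_homNAlg F) h (fun x => (x, k x))) => // [|y].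
  split=> [a y z|y|y z]; apply: (congr2 pair) => //.
  exact: kL.
by rewrite hj /= kj.
Qed.
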